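(* Let $\pi\in M_{2n,2n-1}$ have $\pi(2n-1)=1$. Then, $\pi=[2n-1\ 2n-2\ \dots\ 2\ 1]$ or $\pi=[n+1\ 2\ n+2\ 3\ \dots\ n\ 1]$.
   Context: Permutations $\pi\in S_m$ are bijections $\mathbb Z_m\to\mathbb Z_m$, written $[\pi(1)\ \pi(2)\ \cdots\ \pi(m)]$, with entries represented by $1,\dots,m$. For a positive integer $k$ the pointers are $(k,k+1)$; each entry $x$ has left pointer $(x-1,x)$ and right pointer $(x,x+1)$, and the pointer word $W(\pi)$ lists $L(\pi(1))R(\pi(1))\cdots L(\pi(m))R(\pi(m))$ with $(0,1)$ and $(m,m+1)$ removed. Two distinct pointers $p,q$ form a valid pointer context if they appear in the order $p\ldots q\ldots p\ldots q$ or $q\ldots p\ldots q\ldots p$ in $W(\pi)$. With $\pi=[a_1\ \cdots\ a_m]$, set $X_m=(0\ 1\ \cdots\ m)$, $Y_\pi=(a_m\ a_{m-1}\ \cdots\ a_1\ 0)$ (cycle notation) and $C_\pi=Y_\pi\circ X_m$; the strategic pile $\text{SP}(\pi)$ is the set of numbers after $m$ and before $0$ in the cycle of $C_\pi$ containing $0$ and $m$ (empty if they lie in different cycles). A permutation in $S_{2n}$ has maximal strategic pile if $|\text{SP}(\pi)|=2n-1$; in that case $2n$ appears immediately to the left of $1$, and its contraction is the permutation in $S_{2n-1}$ obtained by deleting the entry $2n$ (with $1$ given left pointer $(2n-1,1)$ and $2n-1$ right pointer $(2n-1,1)$). $M_{2n,k}$ is the set of contractions of permutations in $S_{2n}$ with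 maximal strategic pile and exactly $k$ valid pointer contexts; here $k=2n-1$. *)

(* Defs.v *)
From mathcomp Require Import all_boot all_fingroup.

Set Implicit Arguments.
Unset Strict Implicit.
Unset Printing Implicit Defensive.

(* The ordinal i : 'I_m stands for the position, or the entry, i + 1 of
   {1, ..., m}; hence the one-line word [pi(1) ... pi(m)] has letters in
   {1, ..., m}. *)
Definition oneline (m : nat) (pi : 'S_m) : seq nat :=
  [seq (nat_of_ord (pi i)).+1 | i <- enum 'I_m].

(* The value pi(i) for a position 1 <= i <= m. *)
Definition entry (m : nat) (pi : 'S_m) (i : nat) : nat :=
  nth 0 (oneline pi) i.-1.

Definition pointer (k : nat) : nat * nat := (k, k.+1).

Definition left_pointer (x : nat) : nat * nat := pointer x.-1.
Definition right_pointer (x : nat) : nat * nat := pointer x.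

Definition pointer_word (m : nat) (pi : 'S_m) : seq (nat * nat) :=
  [seq p <- flatten [seq [:: left_pointer x; right_pointer x] | x <- oneline pi]
     | p \notin [:: pointer 0; pointer m]].

Definition valid_context (m : nat) (pi : 'S_m) (p q : nat * nat) : bool :=
  (p != q) && (subseq [:: p; q; p; q] (pointer_word pi)
               || subseq [:: q; p; q; p] (pointer_word pi)).

(* A context is an unordered pair {p, q}, counted once by listing the pointers
   (i, i+1) and (j, j+1) with 1 <= i < j <= m - 1. *)
Definition num_valid_contexts (m : nat) (pi : 'S_m) : nat :=
  #|[set ij : 'I_m * 'I_m | (0 < ij.1 < ij.2)
                            && valid_context pi (pointer ij.1) (pointer ij.2)]|.

(* On a duplicate-free sequence c, [next c] is the cyclic permutation that
   cycle notation writes c.  In Ymap, [lift ord0] sends the ordinal i : 'I_m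
   to i + 1 : 'I_m.+1, so that the sequence is a_m, ..., a_1, 0. *)
Definition Xmap (m : nat) : 'I_m.+1 -> 'I_m.+1 := next (enum 'I_m.+1).

Definition Ymap (m : nat) (pi : 'S_m) : 'I_m.+1 -> 'I_m.+1 :=
  next (rcons (rev [seq lift ord0 (pi i) | i <- enum 'I_m]) ord0).

Definition Cmap (m : nat) (pi : 'S_m) : 'I_m.+1 -> 'I_m.+1 :=
  Ymap pi \o @Xmap m.

Definition strategic_pile (m : nat) (pi : 'S_m) : {set 'I_m.+1} :=
  let c := fingraph.orbit (Cmap pi) ord_max in
  if ord0 \in c then [set x in behead (take (index ord0 c) c)] else set0.

Definition maximal_strategic_pile (n : nat) (sigma : 'S_(2 * n)) : bool :=
  #|strategic_pile sigma| == 2 * n - 1.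

Definition is_contraction (n : nat) (sigma : 'S_(2 * n)) (pi : 'S_(2 * n - 1))
    : bool :=
  oneline pi == rem (2 * n) (oneline sigma).

(* M n k is the set M_{2n,k}. *)
Definition M (n k : nat) : {set 'S_(2 * n - 1)} :=
  [set pi | [exists sigma : 'S_(2 * n),
     [&& maximal_strategic_pile sigma, num_valid_contexts sigma == k
       & is_contraction sigma pi]]].

(* Main.v *)
Require Import Defs.
From mathcomp Require Import all_boot all_fingroup.
From mathcomp Require Import zify.

(** The pointers of sigma are the N = 2n - 1 chords of a chord diagram, the
    contexts being the crossings.  As C_sigma is a single cycle, a set of chords
    that every chord crosses evenly often is empty or everything; in particular
    no chord is free of crossings.  All crossing degrees are even, so N crossings
    force every degree to be 2, and the crossing graph is an N-cycle.  Hence each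
    chord has one side containing only the two ends of its neighbours, which
    means that from x to x + 1 the position in the contraction moves by +2 or by
    -1 modulo N.  A move +2 followed by -1 creates three pairwise crossing
    chords, which is only possible for N = 3; so all moves are equal, which gives
    the two permutations. *)

Set Implicit Arguments.
Unset Strict Implicit.
Unset Printing Implicit Defensive.

(** Let q x be the index of the entry x in the one-line word of sigma.  The two
    occurrences of the pointer (i, i+1) in the unfiltered pointer word, as R(i)
    and as L(i+1), are at the indices 2 q(i) + 1 and 2 q(i+1): they are the ends
    of the chord i. *)
Definition inside (q : nat -> nat) (i t : nat) : bool :=
  minn (2 * q i).+1 (2 * q i.+1) < t < maxn (2 * q i).+1 (2 * q i.+1).

Definition crosses (q : nat -> nat) (i j : nat) : bool :=
  inside q i (2 * q j).+1 (+) inside q i (2 * q j.+1).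

(** * Sums over integer intervals *)

Lemma odd_sum_nat (a b : nat) (F : nat -> nat) :
  odd (\sum_(a <= i < b) F i) = \big[addb/false]_(a <= i < b) odd (F i).
Proof. exact: (big_morph odd oddD). Qed.

Lemma sum_nat_pick (a b x : nat) (S : pred nat) : a <= x < b ->
  \sum_(a <= i < b) (i == x) && S i = S x.
Proof.
move=> hx; rewrite (bigD1_seq x) ?mem_index_iota ?iota_uniq //= eqxx big1 ?addn0 //.
by move=> i /negPf->.
Qed.

Lemma sum_nat_eq0_le (a b : nat) (F : nat -> nat) :
  \sum_(a <= i < b) F i = 0 -> forall x, a <= x < b -> F x = 0.
Proof.
move=> F0 x hx; move: F0.
by rewrite (bigD1_seq x) ?mem_index_iota ?iota_uniq //=; lia.
Qed.

Lemma sum_nat_eq_const (a b c : nat) (F : nat -> nat) :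
    (forall i, a <= i < b -> c <= F i) -> \sum_(a <= i < b) F i = c * (b - a) ->
  forall x, a <= x < b -> F x = c.
Proof.
move=> cF sF x hx.
have := @sum_nat_eq0_le a b (fun i => F i - c) _ x hx; have := cF x hx.
suff -> : \sum_(a <= i < b) (F i - c) = 0 by lia.
have : \sum_(a <= i < b) F i = \sum_(a <= i < b) (F i - c) + \sum_(a <= i < b) c.
  by rewrite -big_split; apply: eq_big_nat => i /cF /=; lia.
by rewrite sF sum_nat_const_nat; lia.
Qed.

(** Handshake lemma: exchanging the two summations carries the pairs above the diagonal to those
    below it. *)
Lemma sum_nat_symmetric (a b : nat) (r : nat -> nat -> bool) :
    (forall i, a <= i < b -> r i i = false) ->
    (forall i j, a <= i < b -> a <= j < b -> r i j = r j i) ->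
  \sum_(a <= i < b) \sum_(a <= j < b) r i j
    = 2 * \sum_(a <= i < b) \sum_(a <= j < b) (i < j) && r i j.
Proof.
move=> rI rC; rewrite mul2n -addnn.
have {2}-> : \sum_(a <= i < b) \sum_(a <= j < b) (i < j) && r i j
    = \sum_(a <= i < b) \sum_(a <= j < b) (j < i) && r j i.
  exact: exchange_big_nat.
rewrite -big_split; apply: eq_big_nat => i hi.
rewrite -big_split; apply: eq_big_nat => j hj /=; have := rC i j hi hj.
by case: ltngtP => [||eij] /=; [lia|lia|rewrite eij rI; lia].
Qed.

(** By injectivity [q] takes each value below [m] exactly once on 1, ..., m. *)
Lemma sum_lt_injective (m j : nat) (q : nat -> nat) : j <= m ->
    (forall x, 1 <= x <= m -> q x < m) ->
    (forall x y, 1 <= x <= m -> 1 <= y <= m -> q x = q y -> x = y) ->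
  \sum_(1 <= x < m.+1) (q x < j) = j.
Proof.
move=> jm qlt qinj.
have -> : \sum_(1 <= x < m.+1) (q x < j) = \sum_(k <- map q (iota 1 m)) (k < j).
  by rewrite big_map /index_iota subn1.
have -> : \sum_(k <- map q (iota 1 m)) (k < j) = \sum_(k <- iota 0 m) (k < j).
  have Uq : uniq (map q (iota 1 m)).
    rewrite map_inj_in_uniq ?iota_uniq // => x y; rewrite !mem_iota => hx hy.
    by apply: qinj; lia.
  apply: perm_big; apply: uniq_perm; rewrite ?iota_uniq //.
  apply: (uniq_min_size Uq _ _).2; last by rewrite size_map !size_iota.
  by move=> k /mapP[x]; rewrite !mem_iota => hx ->; have := qlt x; lia.
rewrite -(subnKC jm) iotaD big_cat /= !big_seq.
rewrite (eq_bigr (fun=> 1)); last by move=> k; rewrite mem_iota; lia.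
rewrite -big_seq sum1_size size_iota big1 ?addn0 // => k; rewrite mem_iota; lia.
Qed.

(** * The chord diagram and its crossing matrix modulo 2 *)

Section Chords.

Variables (N : nat) (q : nat -> nat).
Hypothesis q_lt : forall x, 1 <= x <= N.+1 -> q x < N.+1.
Hypothesis q_inj : forall x y,
  1 <= x <= N.+1 -> 1 <= y <= N.+1 -> q x = q y -> x = y.
(* The gap j precedes the block of index j.  Crossing the chord x leads from
   the gap after the block of x to the gap before the block of x + 1. *)
Hypothesis gap_transitive : forall f : nat -> bool,
  (forall x, 1 <= x <= N -> f (q x.+1) = f (q x).+1) ->
  forall x, 1 <= x <= N -> f (q x).+1 = f N.+1.

Local Notation cr := (crosses q).

Let q_neq x y : 1 <= x <= N.+1 -> 1 <= y <= N.+1 -> x <> y -> q x <> q y.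
Proof. by move=> hx hy + /(q_inj hx hy). Qed.

Lemma crosses_irr i : cr i i = false.
Proof. rewrite /crosses /inside; lia. Qed.

Lemma crosses_sym i j : 1 <= i <= N -> 1 <= j <= N -> cr i j = cr j i.
Proof.
move=> hi hj; case: (eqVneq i j) => [-> //|ij].
have h1 : q i <> q j by apply: q_neq; lia.
have h2 : q i.+1 <> q j.+1 by apply: q_neq; lia.
rewrite /crosses /inside; lia.
Qed.

(** Counts the ends of chords of [S] in the blocks to the left of the gap [j]: the chord s has one
    end in the block of s and one in the block of s + 1. *)
Let letters (S : pred nat) j :=
  \sum_(1 <= s < N.+1) (S s && (q s < j) + S s && (q s.+1 < j)).

(** The blocks between the two gaps joined by the chord x hold the letters inside x, together with
    both ends of x itself if x runs to the left. A chord other than x contributes an odd number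
    exactly when it crosses x, and x contributes 0 or 2. *)
Lemma odd_letters (S : pred nat) x : 1 <= x <= N ->
  odd (letters S (q x.+1)) (+) odd (letters S (q x).+1)
    = odd (\sum_(1 <= s < N.+1) S s && cr x s).
Proof.
move=> hx; rewrite -oddD -big_split /= !odd_sum_nat; apply: eq_big_nat => s hs.
case: (S s) => //=.
have h0 : q x <> q x.+1 by apply: q_neq; lia.
have h3 : q s <> q s.+1 by apply: q_neq; lia.
case: (eqVneq s x) => [-> |ij]; first by rewrite crosses_irr; lia.
have h1 : q x <> q s by apply: q_neq; lia.
have h2 : q x.+1 <> q s.+1 by apply: q_neq; lia.
rewrite /crosses /inside; lia.
Qed.

(* The crossing matrix mod 2 has kernel at most {0, 1}: a kernel vector makes
   the parity of the number of its letters to the left of a gap invariant under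
   the gap walk, so that both letters of each block agree. *)
Lemma crosses_kernel (S : pred nat) :
    (forall x, 1 <= x <= N -> ~~ odd (\sum_(1 <= s < N.+1) S s && cr x s)) ->
  forall x y, 1 <= x <= N -> 1 <= y <= N -> S x = S y.
Proof.
move=> Sker.
have inv x : 1 <= x <= N -> odd (letters S (q x.+1)) = odd (letters S (q x).+1).
  by move=> hx; have := odd_letters S hx; have := Sker x hx; lia.
(* Every block precedes the last gap, so each chord of [S] counts twice there. *)
have ev x : 1 <= x <= N -> odd (letters S (q x).+1) = false.
  move=> hx; rewrite (gap_transitive (f := fun j => odd (letters S j))) //.
  rewrite odd_sum_nat big_nat big1 // => s hs.
  by have := @q_lt s; have := @q_lt s.+1; lia.
(* The block of x + 1 holds one end of the chord x and one of the chord x + 1; the count is even on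
   both sides of this block. *)
have step x : 1 <= x < N -> S x = S x.+1.
  move=> hx; have := ev x.+1 ltac:(lia); have := inv x ltac:(lia).
  rewrite ev; last lia.
  suff -> : letters S (q x.+1).+1 = letters S (q x.+1) + (S x.+1 + S x) by lia.
  rewrite -(sum_nat_pick (x := x.+1) (a := 1) (b := N.+1) S); last lia.
  rewrite -(sum_nat_pick (x := x) (a := 1) (b := N.+1) S); last lia.
  rewrite -!big_split; apply: eq_big_nat => s hs /=; case: (S s); last by rewrite !andbF.
  rewrite !andbT /=.
  have h1 : s <> x.+1 -> q s <> q x.+1 by apply: q_neq; lia.
  have h2 : s <> x -> q s.+1 <> q x.+1 by move=> h; apply: q_neq; lia.
  have [e1|] := eqVneq s x.+1; have [e2|] := eqVneq s x; last lia.
  - lia.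
  - by subst s; move: h2; lia.
  - by subst s; move: h1; lia.
have all1 x : 1 <= x <= N -> S x = S 1.
  by elim: x => [//|[//|x] IH] hx; rewrite -step; [apply: IH; lia|lia].
by move=> i j hi hj; rewrite !all1.
Qed.

(** * Degrees in the crossing graph and the moves of positions *)

Hypothesis N_gt1 : 1 < N.
Hypothesis q1 : q 1 = N.
Hypothesis qN1 : q N.+1 = N.-1.
Hypothesis crosses_count :
  \sum_(1 <= i < N.+1) \sum_(1 <= j < N.+1) (i < j) && cr i j = N.

(** Every block carries two letters, except that 1 has lost its left pointer and N + 1 its right
    pointer. *)
Lemma letters_predT j : j <= N.+1 ->
  letters predT j + (q 1 < j) + (q N.+1 < j) = 2 * j.
Proof.
move=> jN; rewrite /letters big_split /=.
have e := sum_lt_injective jN q_lt q_inj.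
have e2 := e; rewrite big_nat_recl // in e; rewrite big_nat_recr //= in e2.
lia.
Qed.

Let deg x := \sum_(1 <= s < N.+1) cr x s.

Lemma deg_even x : 1 <= x <= N -> ~~ odd (deg x).
Proof.
move=> hx; have := odd_letters predT hx.
rewrite -[X in _ = odd X]/(deg x) => <-.
have q1x : q x.+1 <> q 1 by apply: q_neq; lia.
have qNx : q x <> q N.+1 by apply: q_neq; lia.
have := @letters_predT (q x.+1); have := @letters_predT (q x).+1.
by have := @q_lt x; have := @q_lt x.+1; lia.
Qed.

Lemma deg_gt0 x : 1 <= x <= N -> 0 < deg x.
Proof.
move=> hx; rewrite lt0n; apply/negP => /eqP d0.
have xN y : 1 <= y <= N -> (x == x) = (y == x).
  move=> hy; apply: (@crosses_kernel (pred1 x)) => // z hz.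
  rewrite (sum_nat_pick (cr z)); last lia.
  rewrite crosses_sym //; have := sum_nat_eq0_le d0 (x := z); lia.
by have := xN 1; have := xN 2; rewrite eqxx; lia.
Qed.

Lemma deg_eq2 x : 1 <= x <= N -> deg x = 2.
Proof.
move=> hx; apply: (@sum_nat_eq_const 1 N.+1) => [i hi||]; last lia.
  by have := @deg_even i; have := @deg_gt0 i; lia.
rewrite /deg sum_nat_symmetric ?crosses_count; first lia.
- by move=> i _; rewrite crosses_irr.
- by move=> i j hi hj; apply: crosses_sym; lia.
Qed.

(* By the handshake lemma an even number of edges leaves S, all of them towards
   the neighbours of a; by crosses_kernel that number is not 0. *)
Lemma leaving_crossings a (S : pred nat) s0 :
    1 <= a <= N -> 1 <= s0 <= N -> S s0 -> S a = false ->
    (forall s, 1 <= s <= N -> S s -> cr a s = false) ->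
    (forall s t, 1 <= s <= N -> 1 <= t <= N -> S s -> cr s t -> S t || cr a t) ->
  2 <= \sum_(1 <= i < N.+1) \sum_(1 <= j < N.+1) [&& S i, cr a j & cr i j].
Proof.
move=> ha hs0 Ss0 Sa Na Sout; set E := \sum_(1 <= i < _) _.
(* Sum of the degrees over [S]. A neighbour outside [S] must be a neighbour of a, so [E] counts
   exactly the crossings leaving [S]; they are even in number. *)
have hsum : E + \sum_(1 <= i < N.+1) \sum_(1 <= j < N.+1) [&& S i, S j & cr i j]
    = 2 * \sum_(1 <= i < N.+1) S i.
  rewrite big_distrr -big_split; apply: eq_big_nat => i hi /=.
  rewrite -big_split /=; case Si: (S i); last by rewrite big1.
  rewrite -(@deg_eq2 i); last lia.
  rewrite muln1; apply: eq_big_nat => j hj.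
  have := Na j; have := Sout i j.
  by case: (S j) (cr a j) (cr i j) => [] [] [] /=; lia.
rewrite sum_nat_symmetric in hsum.
- have : E <> 0; last lia.
  move=> E0.
  have E0' i j : 1 <= i <= N -> 1 <= j <= N -> [&& S i, cr a j & cr i j] = false.
    move=> hi hj; have := sum_nat_eq0_le E0 (x := i) ltac:(lia).
    by move/sum_nat_eq0_le => /(_ j ltac:(lia)); lia.
  (* Without leaving crossings every chord crosses either 0 or 2 chords of [S], so [S] is a kernel
     vector. *)
  suff : S a = S s0 by rewrite Sa Ss0.
  apply: crosses_kernel => // x hx; case Sx: (S x).
    suff -> : \sum_(1 <= s < N.+1) S s && cr x s = deg x by rewrite deg_eq2.
    apply: eq_big_nat => s hs; have := Sout x s; have := E0' x s.
    by rewrite Sx; case: (S s) (cr a s) (cr x s) => [] [] [] /=; lia.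
  rewrite big_nat big1 // => s hs.
  have := Sout s x; have := E0' s x; rewrite Sx (@crosses_sym x s); [|lia|lia].
  by case: (S s) (cr a x) (cr s x) => [] [] [] /=; lia.
- by move=> i _; rewrite crosses_irr !andbF.
- by move=> i j hi hj; rewrite (@crosses_sym i j); [case: (S i); case: (S j)|lia|lia].
Qed.

Let enclosed a s := inside q a (2 * q s).+1 && inside q a (2 * q s.+1).
Let apart a s := [&& s != a, ~~ inside q a (2 * q s).+1 & ~~ inside q a (2 * q s.+1)].

Lemma chord_partition a s : enclosed a s + apart a s + (s == a) + cr a s = 1.
Proof.
have [->|] := eqVneq s a; rewrite /enclosed /apart /crosses ?eqxx.
  by rewrite /inside; lia.
by move=> ->; case: (inside _ _ _) (inside _ _ _) => [] [].
Qed.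

(* Otherwise at least two crossings leave each side of the chord a, whereas the
   two neighbours of a have only one further neighbour each. *)
Lemma one_side_empty a : 1 <= a <= N ->
  (forall s, 1 <= s <= N -> enclosed a s = false) \/
  (forall s, 1 <= s <= N -> apart a s = false).
Proof.
move=> ha.
have [|/hasPn h1] := boolP (has (enclosed a) (index_iota 1 N.+1)); last first.
  by left=> s hs; apply/negbTE/h1; rewrite mem_index_iota; lia.
have [|/hasPn h2] := boolP (has (apart a) (index_iota 1 N.+1)); last first.
  by right=> s hs; apply/negbTE/h2; rewrite mem_index_iota; lia.
move=> /hasP[s2 + a2] /hasP[s1 + e1]; rewrite !mem_index_iota => hs2 hs1.
have qaa : q a <> q a.+1 by apply: q_neq; lia.
have E1 : 2 <= \sum_(1 <= i < N.+1) \sum_(1 <= j < N.+1)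
                [&& enclosed a i, cr a j & cr i j].
  apply: (leaving_crossings (s0 := s1)) => //; rewrite /enclosed.
  - by rewrite /inside; lia.
  - by move=> s hs /andP[]; rewrite /crosses => -> ->.
  - move=> s t hs ht; rewrite /crosses /inside; lia.
have E2 : 2 <= \sum_(1 <= i < N.+1) \sum_(1 <= j < N.+1)
                [&& apart a i, cr a j & cr i j].
  apply: (leaving_crossings (s0 := s2)) => //; rewrite /apart.
  - by rewrite eqxx.
  - by move=> s hs /and3P[_]; rewrite /crosses => /negbTE-> /negbTE->.
  - move=> s t hs ht; rewrite /crosses /inside => /and3P[sa].
    have h1 : q s <> q a by apply: q_neq; lia.
    have h2 : q s.+1 <> q a.+1 by apply: q_neq; lia.
    case: (eqVneq t a) => [->|ta] /=; lia.
(* Walks a, j, i of length two: there are four, and two of them return to a. The remaining two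
   cannot account for both [E1] and [E2]. *)
have : \sum_(1 <= i < N.+1) \sum_(1 <= j < N.+1) [&& enclosed a i, cr a j & cr i j]
  + \sum_(1 <= i < N.+1) \sum_(1 <= j < N.+1) [&& apart a i, cr a j & cr i j]
  + \sum_(1 <= i < N.+1) \sum_(1 <= j < N.+1) [&& i == a, cr a j & cr i j]
  <= \sum_(1 <= i < N.+1) \sum_(1 <= j < N.+1) cr a j && cr j i.
  rewrite -!big_split; rewrite !big_nat; apply: leq_sum => i hi /=.
  rewrite -!big_split !big_nat; apply: leq_sum => j hj /=.
  rewrite (@crosses_sym i j); [|lia|lia].
  by have := chord_partition a i; case: (cr a j) (cr j i) => [] [] /=; lia.
rewrite [X in _ <= X]exchange_big_nat.
have -> : \sum_(1 <= j < N.+1) \sum_(1 <= i < N.+1) cr a j && cr j i = 4.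
  transitivity (\sum_(1 <= j < N.+1) 2 * cr a j).
    apply: eq_big_nat => j hj; case: (cr a j); last by rewrite big1.
    by rewrite -(@deg_eq2 j) ?muln1 //; lia.
  by rewrite -big_distrr -/(deg a) deg_eq2.
have -> : \sum_(1 <= i < N.+1) \sum_(1 <= j < N.+1) [&& i == a, cr a j & cr i j] = 2.
  rewrite exchange_big_nat -(@deg_eq2 a) //; apply: eq_big_nat => j hj.
  by rewrite (sum_nat_pick (fun i => cr a j && cr i j)) ?andbb //; lia.
lia.
Qed.

(* The positions after contraction: the adjacent blocks of N + 1 and of 1, at
   indices N - 1 and N, are merged. *)
Let p x := minn (q x) N.-1.

(** The letters between the two gaps are those inside the chord: one for each neighbour, two for
    each enclosed chord. *)
Lemma letters_inside_up a : 1 <= a <= N -> q a < q a.+1 ->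
  letters predT (q a.+1)
    = letters predT (q a).+1 + deg a + 2 * \sum_(1 <= s < N.+1) enclosed a s.
Proof.
move=> ha lt_a; rewrite big_distrr -!big_split; apply: eq_big_nat => s hs /=.
case: (eqVneq s a) => [->|sa].
  by clear -lt_a; rewrite crosses_irr /enclosed /inside; lia.
have h1 : q s <> q a by apply: q_neq; lia.
have h2 : q s.+1 <> q a.+1 by apply: q_neq; lia.
have eR : (q s < q a.+1) = (q s < (q a).+1) + inside q a (2 * q s).+1 :> nat.
  by clear -lt_a h1 h2; rewrite /inside; lia.
have eL : (q s.+1 < q a.+1) = (q s.+1 < (q a).+1) + inside q a (2 * q s.+1) :> nat.
  by clear -lt_a h1 h2; rewrite /inside; lia.
rewrite /crosses /enclosed eR eL.
by case: (inside _ _ _) (inside _ _ _) => [] []; clear; lia.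
Qed.

(** Here the stretch between the gaps also contains the two ends of the chord itself, whence the
    final 2. *)
Lemma letters_inside_down a : 1 <= a <= N -> q a.+1 < q a ->
  letters predT (q a).+1
    = letters predT (q a.+1) + deg a + 2 * \sum_(1 <= s < N.+1) enclosed a s + 2.
Proof.
move=> ha lt_a.
have e2 : 2 = 2 * \sum_(1 <= s < N.+1) (s == a) && predT s.
  by rewrite sum_nat_pick //; lia.
rewrite [X in _ = _ + X]e2.
rewrite !big_distrr -!big_split; apply: eq_big_nat => s hs /=.
case: (eqVneq s a) => [->|sa].
  by clear -lt_a; rewrite crosses_irr /enclosed /inside; lia.
have h1 : q s <> q a by apply: q_neq; lia.
have h2 : q s.+1 <> q a.+1 by apply: q_neq; lia.
have eR : (q s < (q a).+1) = (q s < q a.+1) + inside q a (2 * q s).+1 :> nat.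
  by clear -lt_a h1 h2; rewrite /inside; lia.
have eL : (q s.+1 < (q a).+1) = (q s.+1 < q a.+1) + inside q a (2 * q s.+1) :> nat.
  by clear -lt_a h1 h2; rewrite /inside; lia.
rewrite /crosses /enclosed eR eL.
by case: (inside _ _ _) (inside _ _ _) => [] []; clear; lia.
Qed.

Lemma sum_enclosed_apart a : 1 <= a <= N ->
  \sum_(1 <= s < N.+1) enclosed a s + \sum_(1 <= s < N.+1) apart a s + 3 = N.
Proof.
move=> ha.
have : \sum_(1 <= s < N.+1) 1 = N by rewrite sum_nat_const_nat; lia.
rewrite -{1}(eq_big_nat _ _ (fun s _ => chord_partition a s)) !big_split /=.
rewrite -/(deg a) deg_eq2 //.
have : \sum_(1 <= s < N.+1) (s == a) && predT s = 1 by rewrite sum_nat_pick //; lia.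
under eq_bigr do rewrite andbT.
by clear; lia.
Qed.

(** The number of letters between the two gaps of the chord is determined by the number of enclosed
    chords, which is 0 or N - 3 by [one_side_empty]. The four cases are +2 and -1 modulo N. *)
Lemma chord_step a : 1 <= a <= N ->
  [\/ p a.+1 = p a + 2, p a.+1 + N = p a + 2, p a.+1 + 1 = p a
    | p a.+1 + 1 = p a + N].
Proof.
move=> ha.
have q1a : q a.+1 <> q 1 by apply: q_neq; lia.
have qNa : q a <> q N.+1 by apply: q_neq; lia.
have ltqa : q a < N.+1 by apply: q_lt; lia.
have ltqa1 : q a.+1 < N.+1 by apply: q_lt; lia.
(* After the merger of N + 1 and 1 every block has exactly two letters. *)
have e1 : letters predT (q a.+1) = 2 * p a.+1.
  have := @letters_predT (q a.+1) ltac:(lia).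
  by rewrite /p; move: N_gt1 q1 qN1 q1a ltqa1; clear; lia.
have e2 : letters predT (q a).+1 = 2 * (p a).+1.
  have := @letters_predT (q a).+1 ltac:(lia).
  by rewrite /p; move: N_gt1 q1 qN1 qNa ltqa; clear; lia.
have tot := sum_enclosed_apart ha.
have k_cases : \sum_(1 <= s < N.+1) enclosed a s = 0
            \/ \sum_(1 <= s < N.+1) enclosed a s = N - 3.
  have [h|h] := one_side_empty ha; [left|right].
    by rewrite big_nat big1 // => s /h ->.
  have z : \sum_(1 <= s < N.+1) apart a s = 0 by rewrite big_nat big1 // => s /h ->.
  by move: tot; rewrite z; clear; lia.
have [lt_a|lt_a|] := ltngtP (q a) (q a.+1); last by have := @q_neq a a.+1; lia.
- have := letters_inside_up ha lt_a; rewrite e1 e2 deg_eq2 //.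
  move: tot k_cases; clear.
  case: (\sum_(_ <= _ < _) enclosed _ _) => [|k] tot [] kE pE.
  + by constructor 1; lia.
  + by constructor 4; lia.
  + lia.
  + by constructor 4; lia.
- have := letters_inside_down ha lt_a; rewrite e1 e2 deg_eq2 //.
  move: tot k_cases; clear.
  case: (\sum_(_ <= _ < _) enclosed _ _) => [|k] tot [] kE pE.
  + by constructor 3; lia.
  + by constructor 3; lia.
  + lia.
  + by constructor 2; lia.
Qed.

Lemma p_lt x : p x < N.
Proof. by rewrite /p; lia. Qed.

Lemma p_inj x y : 1 <= x <= N -> 1 <= y <= N -> p x = p y -> x = y.
Proof.
move=> hx hy; have [//|/eqP xy] := eqVneq x y.
have h1 : q x <> q y by apply: q_neq; lia.
have h2 : q x <> q N.+1 by apply: q_neq; lia.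
have h3 : q y <> q N.+1 by apply: q_neq; lia.
by have := @q_lt x; have := @q_lt y; rewrite /p; lia.
Qed.

Lemma crosses_neighbours a b c : 1 <= a <= N -> 1 <= b <= N -> 1 <= c <= N ->
    b != c -> cr a b -> cr a c ->
  forall s, 1 <= s <= N -> cr a s = (s == b) || (s == c).
Proof.
move=> ha hb hc bc ab ac s hs; have := deg_eq2 ha; rewrite /deg.
have -> : \sum_(1 <= i < N.+1) cr a i
    = \sum_(1 <= i < N.+1) (i == b) && cr a i
      + \sum_(1 <= i < N.+1) (i == c) && cr a i
      + \sum_(1 <= i < N.+1) [&& cr a i, i != b & i != c].
  rewrite -!big_split; apply: eq_big_nat => i _ /=.
  case: (eqVneq i b) => [->|_]; first by rewrite (negPf bc); case: (cr a b).
  by case: (i == c); case: (cr a i).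
rewrite !sum_nat_pick ?ab ?ac; [|lia|lia].
move=> e; have {e} /sum_nat_eq0_le : \sum_(1 <= i < N.+1) [&& cr a i, i != b & i != c] = 0.
  by move: e; clear; lia.
move=> /(_ s hs); case: (eqVneq s b) => [->|_] //=.
by case: (eqVneq s c) => [->|_] //=; case: (cr a s).
Qed.

(** As all degrees are 2, a triangle is a whole component of the crossing graph. Its indicator is
    then a kernel vector, hence constant. *)
Lemma no_crossing_triangle a b c :
    1 <= a <= N -> 1 <= b <= N -> 1 <= c <= N -> a != b -> b != c -> a != c ->
    cr a b -> cr a c -> cr b c -> N <= 3.
Proof.
move=> ha hb hc ab bc ac cab cac cbc.
have na := crosses_neighbours ha hb hc bc cab cac.
have nb := crosses_neighbours hb ha hc ac.
rewrite crosses_sym // in nb; have {}nb := nb cab cbc.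
have nc := crosses_neighbours hc ha hb ab.
rewrite (@crosses_sym c a) // (@crosses_sym c b) // in nc; have {}nc := nc cac cbc.
have Sker x : 1 <= x <= N ->
    ~~ odd (\sum_(1 <= s < N.+1) [|| s == a, s == b | s == c] && cr x s).
  move=> hx.
  have -> : \sum_(1 <= s < N.+1) [|| s == a, s == b | s == c] && cr x s
    = \sum_(1 <= s < N.+1) (s == a) && cr x s
      + \sum_(1 <= s < N.+1) (s == b) && cr x s
      + \sum_(1 <= s < N.+1) (s == c) && cr x s.
    rewrite -!big_split; apply: eq_big_nat => i _ /=.
    case: (eqVneq i a) => [->|_]; first by rewrite (negPf ab) (negPf ac) /= !addn0.
    by case: (eqVneq i b) => [->|_]; rewrite ?(negPf bc) //= ?addn0.
  rewrite !sum_nat_pick // !(@crosses_sym x) // na // nb // nc //.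
  case: (eqVneq x a) => [->|_]; first by rewrite (negPf ab) (negPf ac).
  by case: (eqVneq x b) => [->|_]; rewrite ?(negPf bc) //; case: (x == c).
have all_S y : 1 <= y <= N -> [|| y == a, y == b | y == c].
  by move=> hy; rewrite (crosses_kernel Sker hy ha) eqxx.
rewrite leqNgt; apply/negP => N_gt3.
have := all_S 1; have := all_S 2; have := all_S 3; have := all_S 4.
by move: N_gt3; clear; lia.
Qed.

(** * Uniformity of the moves *)

Let up a := p a.+1 = p a + 2 \/ p a.+1 + N = p a + 2.
Let down a := p a.+1 + 1 = p a \/ p a.+1 + 1 = p a + N.
(** The cyclic successor on 1, ..., N; it is compatible with [p] because N + 1 and 1 share a
    position after contraction. *)
Let nx a := if a == N then 1 else a.+1.

Lemma p_nx a : p (nx a) = p a.+1.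
Proof. by rewrite /nx; case: eqVneq => [->|//]; rewrite /p q1 qN1; lia. Qed.

Lemma nxP a : nx a = 1 /\ a = N \/ nx a = a.+1 /\ a <> N.
Proof. by rewrite /nx; case: eqVneq => [->|/eqP]; [left|right]. Qed.

Lemma up_or_down a : 1 <= a <= N -> up a \/ down a.
Proof. by move=> /chord_step []; rewrite /up /down; lia. Qed.

Lemma q_of_p x : 1 <= x <= N ->
  q x.+1 = p (nx x) /\ (q x = p x \/ q x = N /\ p x = N.-1).
Proof.
move=> hx; rewrite p_nx /p.
have h1 : q x.+1 <> q 1 by apply: q_neq; lia.
have h2 : q x <> q N.+1 by apply: q_neq; lia.
have := @q_lt x; have := @q_lt x.+1; lia.
Qed.

Lemma up_nx a : 3 < N -> 1 <= a <= N -> up a -> up (nx a).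
Proof.
move=> N_gt3 ha; have nxa := nxP a; have nxb := nxP (nx a).
have nxc := nxP (nx (nx a)).
have hb : 1 <= nx a <= N by lia.
have [//|] := up_or_down hb; rewrite /up /down -!p_nx.
set b := nx a in hb nxa nxb nxc *; have hc : 1 <= nx b <= N by lia.
have := up_or_down hc; rewrite /up /down -!p_nx; set c := nx b in hc nxb nxc *.
have hd : 1 <= nx c <= N by lia.
have ab : a != b by lia.
have bc : b != c by lia.
have ac : a != c by lia.
have cda : nx c <> a by lia.
have pda : p (nx c) <> p a by move=> /(p_inj hd ha).
have plta := p_lt a; have pltb := p_lt b; have pltc := p_lt c; have pltd := p_lt (nx c).
(* The third move is +2 again: the moves +2, -1, -1 would return to the position of a, while N > 3
   makes the four entries distinct. *)
move=> stc stb sta; have {pda}stc : p (nx c) = p c + 2 \/ p (nx c) + N = p c + 2.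
  by clear -stc stb sta pda plta pltb pltc pltd; lia.
exfalso; suff : N <= 3 by lia.
have [qa qa'] := q_of_p ha; have [qb qb'] := q_of_p hb; have [qc qc'] := q_of_p hc.
(* If a has position t, the chords lead from t to t + 2, from t + 2 to t + 1 and from t + 1 to t + 3
   modulo N. Up to rotation their ends come in the order a, b, c, a, b, c. *)
apply: (@no_crossing_triangle a b c) => //; rewrite /crosses /inside ?qa ?qb ?qc -?/b -?/c.
- clear -N_gt3 qa' qb' qc' sta stb stc plta pltb pltc pltd.
  by case: sta; case: stb; case: qa'; case: qb'; lia.
- clear -N_gt3 qa' qb' qc' sta stb stc plta pltb pltc pltd.
  by case: sta; case: stb; case: stc; case: qa'; case: qc'; lia.
- clear -N_gt3 qa' qb' qc' sta stb stc plta pltb pltc pltd.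
  by case: sta; case: stb; case: stc; case: qb'; case: qc'; lia.
Qed.

Lemma steps_uniform :
  (forall a, 1 <= a <= N -> up a) \/ (forall a, 1 <= a <= N -> down a).
Proof.
have N_ge3 : 3 <= N by have := @sum_enclosed_apart 1; lia.
(* For N = 3 the moves +2 and -1 coincide modulo N. *)
have [N_gt3|N_le3] := ltnP 3 N; last first.
  by left=> a /up_or_down; rewrite /up /down; lia.
have up_next a : 1 <= a < N -> up a -> up a.+1.
  by move=> ha /(up_nx N_gt3); rewrite /nx; case: eqVneq => [|_]; last apply; lia.
have up_from a b : 1 <= a -> a <= b <= N -> up a -> up b.
  move=> a1 hab ua; elim: b hab => [|b IH] hab; first lia.
  have [<- //|ne] := eqVneq a b.+1; apply: up_next; first lia.
  by apply: IH; lia.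
have upN : up N -> up 1.
  by have := @up_nx N N_gt3; rewrite /nx eqxx; apply; lia.
have [u1|nu1] : up 1 \/ ~ up 1 by rewrite /up; lia.
  by left=> a ha; apply: (up_from 1) => //; lia.
right=> a ha; have [ua|//] := up_or_down ha; case: nu1; apply: upN.
by apply: (up_from a) => //; lia.
Qed.

(** The entry 1 is last. Moves -1 then list the entries in decreasing order. Moves +2 first wrap
    round to position 1 and place 2, ..., n at the odd positions, then wrap round to 0 and place n +
    1, ..., 2n - 1 at the even ones. *)
Lemma block_positions n : N = 2 * n - 1 ->
  (forall x, 1 <= x <= N -> p x = N - x) \/
  (forall i, 1 <= i < n -> p i.+1 = 2 * i - 1 /\ p (n + i) = 2 * (i - 1)).
Proof.
move=> Nn; have p1 : p 1 = N.-1 by rewrite /p q1; lia.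
have [ups|downs] := steps_uniform; [right|left].
  have low i : 1 <= i < n -> p i.+1 = 2 * i - 1.
    elim: i => [//|i IH] hi; have := ups i.+1 ltac:(lia); have := p_lt i.+2.
    case: i IH hi => [|i] IH hi; first by rewrite /up p1; lia.
    by rewrite /up IH; lia.
  have high i : 1 <= i < n -> p (n + i) = 2 * (i - 1).
    elim: i => [//|i IH] hi; have := ups (n + i) ltac:(lia); have := p_lt (n + i).+1.
    rewrite addnS; case: i IH hi => [|i] IH hi.
      have := low n.-1 ltac:(lia); rewrite addn0 prednK /up; lia.
    by rewrite /up IH; lia.
  by move=> i hi; rewrite low // high.
elim=> [//|x IH] hx; have := p_lt x.+1.
case: x IH hx => [|x] IH hx; first by rewrite p1; lia.
have := downs x.+1 ltac:(lia); rewrite /down IH; lia.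
Qed.

End Chords.

(** * Subsequences, pointer words and one-line words *)

Lemma subseq_nthP (T : eqType) (x0 : T) (s t : seq T) :
  reflect (exists idx, [/\ sorted ltn idx, all (gtn (size t)) idx
                         & s = map (nth x0 t) idx])
          (subseq s t).
Proof.
apply: (iffP idP) => [/subseqP[mk sz ->]|[idx [srt /allP lt_idx ->]]].
  exists (mask mk (iota 0 (size t))); split.
  - by apply: (sorted_mask ltn_trans); apply: iota_ltn_sorted.
  - by apply/allP => i /mem_mask; rewrite mem_iota.
  - by rewrite map_mask -/(mkseq _ _) mkseq_nth.
rewrite -[X in subseq _ X](mkseq_nth x0 t); apply: map_subseq.
suff -> : idx = [seq i <- iota 0 (size t) | i \in idx] by apply: filter_subseq.
apply: (irr_sorted_eq ltn_trans ltnn) => //.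
  by apply: sorted_filter; [apply: ltn_trans|apply: iota_ltn_sorted].
move=> i; rewrite mem_filter mem_iota /=.
by case ii: (i \in idx) => //=; rewrite add0n; have /= -> := lt_idx _ ii.
Qed.

(** Both letters occur at known positions only, so the increasing choice of four indices is
    forced. *)
Lemma subseq4_positions (T : eqType) (t : seq T) (a b : T) (i j k l : nat) (x0 : T) :
    i < size t -> j < size t -> k < size t -> l < size t ->
    (forall n, n < size t -> (nth x0 t n == a) = (n == i) || (n == j)) ->
    (forall n, n < size t -> (nth x0 t n == b) = (n == k) || (n == l)) ->
  subseq [:: a; b; a; b] t
    = (minn i j < minn k l) && (minn k l < maxn i j < maxn k l).
Proof.
move=> hi hj hk hl ta tb; apply/(subseq_nthP x0)/idP.
  case=> -[|n0 [|n1 [|n2 [|n3 [|? ?]]]]] [//=].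
  move=> /and4P[l01 l12 l23 _] /and5P[s0 s1 s2 s3 _] [] e0 e1 e2 e3.
  have := ta n0 s0; have := tb n1 s1; have := ta n2 s2; have := tb n3 s3.
  rewrite -e0 -e1 -{}e2 -{}e3 !eqxx; move: l01 l12 l23; clear; lia.
move=> h; exists [:: minn i j; minn k l; maxn i j; maxn k l]; split.
- by move: h; rewrite /=; clear; lia.
- by move: hi hj hk hl; rewrite /=; clear; lia.
have ea n : (n == i) || (n == j) -> nth x0 t n = a.
  by move=> nij; apply/eqP; rewrite ta //; case/orP: nij => /eqP->.
have eb n : (n == k) || (n == l) -> nth x0 t n = b.
  by move=> nij; apply/eqP; rewrite tb //; case/orP: nij => /eqP->.
by rewrite /= (ea (minn i j)) ?(ea (maxn i j)) ?(eb (minn k l)) ?(eb (maxn k l)) //; lia.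
Qed.

Lemma nth_flatten_pairs (T : Type) (x0 : T) (f g : nat -> T) (s : seq nat) k :
  nth x0 (flatten [seq [:: f x; g x] | x <- s]) k
    = if k < 2 * size s then (if odd k then g else f) (nth 0 s k./2) else x0.
Proof.
elim: s k => [|x s IH] k; first by rewrite muln0 ltn0 nth_nil.
rewrite [size _]/= mulnS; case: k => [|[|k]] //=; rewrite IH negbK.
by rewrite (_ : (k.+2 < 2 + 2 * size s) = (k < 2 * size s)) //; lia.
Qed.

Lemma size_flatten_pairs (T : Type) (f g : nat -> T) (s : seq nat) :
  size (flatten [seq [:: f x; g x] | x <- s]) = 2 * size s.
Proof. by elim: s => //= x s ->; lia. Qed.

Lemma size_oneline m (pi : 'S_m) : size (oneline pi) = m.
Proof. by rewrite size_map size_enum_ord. Qed.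

Lemma oneline_uniq m (pi : 'S_m) : uniq (oneline pi).
Proof.
by rewrite map_inj_uniq ?enum_uniq // => i j [] /val_inj /perm_inj.
Qed.

Lemma mem_oneline m (pi : 'S_m) x : (x \in oneline pi) = (1 <= x <= m).
Proof.
apply/mapP/idP => [[i _ ->]|]; first by rewrite ltn_ord.
case: x => // x /= xm; exists ((pi^-1)%g (Ordinal xm)); rewrite ?mem_enum //.
by rewrite permKV.
Qed.

Lemma nth_eq_index m (pi : 'S_m) k x : k < m -> 1 <= x <= m ->
  (nth 0 (oneline pi) k == x) = (k == index x (oneline pi)).
Proof.
move=> km hx; apply/eqP/eqP => [<-|->].
  by rewrite index_uniq ?size_oneline ?oneline_uniq.
by rewrite nth_index // mem_oneline.
Qed.

(** * Valid contexts as crossings *)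

Section Contexts.

Variables (m : nat) (sigma : 'S_m).
Let q x := index x (oneline sigma).

Lemma index_oneline_lt x : 1 <= x <= m -> q x < m.
Proof. by move=> hx; rewrite -[X in _ < X](size_oneline sigma) index_mem mem_oneline. Qed.

Lemma index_oneline_inj x y : 1 <= x <= m -> 1 <= y <= m -> q x = q y -> x = y.
Proof.
move=> hx hy e; rewrite -(@nth_index _ 0 x (oneline sigma)) ?mem_oneline //.
by rewrite -/(q x) e nth_index ?mem_oneline.
Qed.

(** The filter keeps both pointers, so subsequences may be sought in the unfiltered word, where the
    chord ends are explicit indices. *)
Lemma valid_context_crosses i j : 0 < i -> i < j -> j < m ->
  valid_context sigma (pointer i) (pointer j) = crosses q i j.
Proof.
move=> i0 ij jm; rewrite /valid_context /pointer_word !subseq_filter /=.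
have -> : pointer i != pointer j by apply/eqP => -[]; lia.
have ok k : 0 < k < m -> pointer k \notin [:: pointer 0; pointer m].
  by move=> hk; rewrite !inE /pointer !xpair_eqE; lia.
rewrite !ok ?andbT /=; [|lia|lia].
set t := flatten _.
have st : size t = 2 * m by rewrite size_flatten_pairs size_oneline.
have ht k : 0 < k < m -> forall n, n < size t ->
    (nth (0, 0) t n == pointer k) = (n == (2 * q k).+1) || (n == 2 * q k.+1).
  move=> hk n; rewrite st => nm; rewrite nth_flatten_pairs size_oneline nm.
  have n2 : n./2 < m by lia.
  have e1 := @nth_eq_index m sigma n./2 k n2 ltac:(lia).
  have e2 := @nth_eq_index m sigma n./2 k.+1 n2 ltac:(lia).
  rewrite -!/(q _) in e1 e2.
  have x0 : 1 <= nth 0 (oneline sigma) n./2 <= m.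
    by rewrite -(mem_oneline sigma) mem_nth // size_oneline.
  rewrite /left_pointer /right_pointer /pointer.
  case: ifP => on; rewrite xpair_eqE; move: e1 e2 on x0; clear; lia.
have [lqi lqi1] : q i < m /\ q i.+1 < m by split; apply: index_oneline_lt; lia.
have [lqj lqj1] : q j < m /\ q j.+1 < m by split; apply: index_oneline_lt; lia.
have h1 : q i <> q j by move=> /index_oneline_inj; lia.
have h2 : q i.+1 <> q j.+1 by move=> /index_oneline_inj; lia.
rewrite (subseq4_positions _ _ _ _ (ht i _) (ht j _)) ?st; try lia.
rewrite (subseq4_positions _ _ _ _ (ht j _) (ht i _)) ?st; try lia.
move: h1 h2; rewrite /crosses /inside; clear; lia.
Qed.

Lemma num_valid_contexts_sum :
  num_valid_contexts sigma
    = \sum_(1 <= i < m) \sum_(1 <= j < m) (i < j) && crosses q i j.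
Proof.
rewrite /num_valid_contexts -sum1_card big_mkcond /=.
under eq_bigr do rewrite inE.
rewrite -(pair_bigA _ (fun i j : 'I_m => if (0 < i < j) &&
  valid_context sigma (pointer i) (pointer j) then 1 else 0)) /=.
rewrite big_geq_mkord /= [RHS]big_mkcond; apply: eq_bigr => i _.
rewrite big_geq_mkord /=; case: ifP => i0 /=; last by rewrite big1.
rewrite [RHS]big_mkcond; apply: eq_bigr => j _ /=.
have [ij|] := ltnP i j; last by case: ifP.
by rewrite valid_context_crosses // (leq_trans _ ij) //=; case: crosses.
Qed.

(** * The strategic pile as a walk on gaps *)

Let s := [seq lift ord0 (sigma i) | i <- enum 'I_m].

(* The gap after the entry y, the gap 0 lying before all the entries. *)
Let gap (y : 'I_m.+1) := index y (ord0 :: s).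

Lemma index_word (x : 'I_m.+1) : index x s = q x.
Proof.
by rewrite -(index_map val_inj) -map_comp.
Qed.

Lemma word_uniq : uniq (ord0 :: s).
Proof.
rewrite cons_uniq map_inj_uniq ?enum_uniq ?andbT; last first.
  by apply: inj_comp perm_inj; apply: lift_inj.
by apply/mapP => -[i _] /eqP; rewrite (negPf (neq_lift _ _)).
Qed.

Lemma mem_word (x : 'I_m.+1) : x \in ord0 :: s.
Proof.
rewrite inE; case: (unliftP ord0 x) => [i ->|-> //]; apply/orP; right.
by apply/mapP; exists ((sigma^-1)%g i); rewrite ?mem_enum ?permKV.
Qed.

Lemma Ymap_prev : Ymap sigma =1 prev (ord0 :: s).
Proof. by move=> x; rewrite /Ymap -rev_cons next_rev // word_uniq. Qed.

Lemma gapE (y : 'I_m.+1) : gap y = if y == ord0 then 0 else (q y).+1.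
Proof. by rewrite /gap /= eq_sym index_word. Qed.

(** At x = 0 both sides are m: 0 is absent from the one-line word, so its [index] is the length, and
    its cyclic predecessor is the last entry. *)
Lemma gap_Ymap x : gap (Ymap sigma x) = q x.
Proof.
rewrite Ymap_prev prev_nth mem_word /gap index_uniq ?word_uniq ?index_word //.
by rewrite -index_word /= ltnS index_size.
Qed.

Lemma XmapE (x : 'I_m.+1) : Xmap x = (if x < m then x.+1 else 0) :> nat.
Proof.
rewrite /Xmap next_nth mem_enum /= index_enum_ord enum_ordSl.
case: ltnP => xm; last by rewrite nth_default // size_map size_enum_ord.
rewrite (nth_map (Ordinal xm)) ?size_enum_ord // lift0.
by rewrite nth_enum_ord.
Qed.

Lemma gap_Cmap (x : 'I_m.+1) : gap (Cmap sigma x) = if x < m then q x.+1 else m.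
Proof.
rewrite /Cmap /= gap_Ymap XmapE; case: ifP => // _.
by rewrite /q memNindex ?size_oneline // mem_oneline.
Qed.

Lemma Cmap_inj : injective (Cmap sigma).
Proof.
apply: inj_comp => [x y|]; last exact: can_inj (prev_next (enum_uniq _)).
by rewrite !Ymap_prev; apply: can_inj (next_prev word_uniq) _ _.
Qed.

Hypothesis m_gt1 : 1 < m.
Hypothesis max_pile : #|strategic_pile sigma| = m - 1.

Let c := fingraph.orbit (Cmap sigma) ord_max.

(** The pile lies strictly between m, at index 0 of [c], and 0; having m - 1 elements, it puts 0 at
    index m. *)
Lemma index0_orbit : index ord0 c = m.
Proof.
move: max_pile; rewrite /strategic_pile -/c; case: ifP => [c0|_]; last first.
  by rewrite cards0; lia.
rewrite cardsE; have Uc : uniq (behead (take (index ord0 c) c)).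
  by rewrite -drop1 drop_uniq // take_uniq // orbit_uniq.
rewrite (card_uniqP Uc) size_behead size_takel ?index_size //.
by move: m_gt1; clear; lia.
Qed.

Lemma size_orbit_pile : size c = m.+1.
Proof.
apply/eqP; rewrite eqn_leq; apply/andP; split.
  by rewrite -(card_uniqP (orbit_uniq _ _)) -[X in _ <= X](card_ord m.+1) max_card.
rewrite ltnNge; apply/negP => le_c.
have := index0_orbit; rewrite /c => i0.
have c0 : ord0 \notin c by rewrite -index_mem i0 -leqNgt.
move: max_pile; rewrite /strategic_pile -/c (negPf c0) cards0.
by move: m_gt1; clear; lia.
Qed.

Lemma nth_orbit j : j <= m -> nth ord_max c j = iter j (Cmap sigma) ord_max.
Proof.
by move=> jm; rewrite nth_traject // -[X in _ < X](size_orbit _ ord_max) -/c size_orbit_pile.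
Qed.

Lemma index_iter_Cmap j : j <= m -> index (iter j (Cmap sigma) ord_max) c = j.
Proof.
by move=> jm; rewrite -nth_orbit // index_uniq ?orbit_uniq // size_orbit_pile.
Qed.

Lemma iter_Cmap_surj (y : 'I_m.+1) :
  exists2 j, j <= m & y = iter j (Cmap sigma) ord_max.
Proof.
have yc : y \in c.
  have /subset_cardP : #|c| = #|{: 'I_m.+1}|.
    by rewrite (card_uniqP (orbit_uniq _ _)) -/c size_orbit_pile card_ord.
  by move=> /(_ (subset_predT _)) ->.
have jm : index y c <= m by move: yc; rewrite -index_mem size_orbit_pile.
by exists (index y c); rewrite // -nth_orbit // nth_index.
Qed.

(** The cycle starting at m ends with 0, so 0 is mapped to m; on gaps this identifies the gap before
    1 with the gap after m. *)
Lemma index_max_succ : q 1 = (q m).+1.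
Proof.
have m0 : m != 0 by move: m_gt1; clear; lia.
have C0 : Cmap sigma ord0 = ord_max.
  have [j jm e0] := iter_Cmap_surj ord0.
  have := index_iter_Cmap jm; rewrite -e0 index0_orbit => mj.
  have := iter_order Cmap_inj ord_max.
  rewrite -[fingraph.order _ _](size_orbit (Cmap sigma)) -/c size_orbit_pile /=.
  by rewrite -mj in e0; rewrite -e0.
have := gap_Cmap ord0; rewrite C0 gapE /= lt0n m0.
by rewrite -val_eqE /= (negPf m0).
Qed.

(** The first step from m leads to the gap m. The cycle then meets every x < m other than 0 before
    it reaches 0, and [f] is invariant under each of these steps. *)
Lemma pile_gap_transitive (f : nat -> bool) :
    (forall x, 1 <= x < m -> f (q x.+1) = f (q x).+1) ->
  forall x, 1 <= x < m -> f (q x).+1 = f m.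
Proof.
move=> finv.
have fiter j : 1 <= j <= m -> f (gap (iter j (Cmap sigma) ord_max)) = f m.
  elim: j => [//|j IH] hj; rewrite iterS gap_Cmap.
  case: j IH hj => [|j] IH hj; first by rewrite /= ltnn.
  set z := iter _ _ _; have iz : index z c = j.+1 by apply: index_iter_Cmap; lia.
  have z0 : z != ord0.
    by apply/eqP => ez; move: iz; rewrite ez index0_orbit; lia.
  have zm : z < m.
    rewrite ltn_neqAle -ltnS ltn_ord andbT; apply/eqP => ez.
    have ez' : z = iter 0 (Cmap sigma) ord_max by apply: val_inj.
    by move: iz; rewrite ez' index_iter_Cmap.
  rewrite zm finv; last by rewrite zm andbT lt0n.
  by rewrite -IH -/z ?gapE ?(negPf z0) //; lia.
move=> x hx; have xm : x < m.+1 by lia.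
have [j jm ej] := iter_Cmap_surj (Ordinal xm).
have j0 : j != 0.
  by apply/eqP => j0; move: ej; rewrite j0 => /(congr1 val) /=; lia.
rewrite -(fiter j); last by rewrite lt0n j0.
by rewrite -ej gapE -val_eqE /=; case: eqVneq => // x0; lia.
Qed.

End Contexts.

(** * Reading off the contraction *)

Lemma eq_of_index (s t : seq nat) : size s = size t ->
  (forall k, k < size t -> index (nth 0 t k) s = k) -> s = t.
Proof.
move=> st h; apply: (@eq_from_nth _ 0) => // k; rewrite st => kt.
have e := h k kt; rewrite -{1}e nth_index // -index_mem e st //.
Qed.

(** Write w as u, z, 1, v. Deleting z leaves 1 right after u, and being the last letter it forces v
    to be empty. *)
Lemma nth_rem_last_one (w : seq nat) (z : nat) : uniq w -> z \in w -> 1 \in w ->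
    index 1 w = (index z w).+1 -> nth 0 (rem z w) (size w).-2 = 1 ->
  exists u, w = rcons (rcons u z) 1 /\ rem z w = rcons u 1.
Proof.
move=> Uw Mw w1 i1; rewrite remE.
have iM : index z w < size w by rewrite index_mem.
have iM1 : (index z w).+1 < size w by rewrite -i1 index_mem.
have dM : drop (index z w) w = z :: 1 :: drop (index z w).+2 w.
  by rewrite (drop_nth 0) // nth_index // (drop_nth 0) // -{1}i1 nth_index.
have dM1 : drop (index z w).+1 w = 1 :: drop (index z w).+2 w.
  by rewrite (drop_nth 0) // -{1}i1 nth_index.
have eW := cat_take_drop (index z w) w; rewrite dM in eW; rewrite dM1.
have su : size (take (index z w) w) = index z w by rewrite size_takel // ltnW.
set u := take _ w in eW su *; set v := drop _ w in eW *.
have : uniq (u ++ 1 :: v) by rewrite -{}eW !(cat_uniq, cons_uniq) /= in Uw *;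
  move: Uw; rewrite !inE !negb_or; case/and3P=> -> /and3P[_ -> ->] /and3P[_ -> ->].
move=> U1 nlast.
have sw : size w = size u + (size v).+2 by rewrite -eW size_cat.
have : index (nth 0 (u ++ 1 :: v) (size w).-2) (u ++ 1 :: v) = (size w).-2.
  by apply: index_uniq => //; rewrite size_cat sw /=; lia.
rewrite nlast index_cat; case: ifP => [|_].
  by move: U1; rewrite cat_uniq /= negb_or => /and3P[_ /andP[/negPf-> _] _].
rewrite /= addn0 sw => ev; have v0 : v = [::] by apply: size0nil; lia.
by exists u; rewrite -eW v0 !cats1 -cat_rcons cats1.
Qed.

Theorem theorem4p19 (n : nat) (hn : 0 < n) (pi : 'S_(2 * n - 1))
    (hpi : pi \in M n (2 * n - 1)) (hlast : entry pi (2 * n - 1) = 1) :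
  oneline pi = rev (iota 1 (2 * n - 1))
  \/ oneline pi = rcons (flatten [seq [:: n + i; i.+1] | i <- iota 1 (n - 1)]) 1.
Proof.
have [n1|n_gt1] := leqP n 1.
  left; have en : n = 1 by lia.
  subst n; move: hlast (size_oneline pi); rewrite /entry.
  by case: (oneline pi) => [|x [|]] //= ->.
move: hpi; rewrite inE => /existsP[sigma /and3P[/eqP pile /eqP cnt /eqP contr]].
have m_gt1 : 1 < 2 * n by lia.
set w := oneline sigma in contr.
have i1 : index 1 w = (index (2 * n) w).+1 := index_max_succ m_gt1 pile.
have sw : size w = 2 * n := size_oneline sigma.
have [u [wE piE]] : exists u, w = rcons (rcons u (2 * n)) 1 /\ rem (2 * n) w = rcons u 1.
  apply: nth_rem_last_one => //; rewrite ?oneline_uniq ?mem_oneline //; try lia.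
  rewrite -contr sw -[RHS]hlast /entry; congr nth; lia.
rewrite -contr in piE.
have su : size u = 2 * n - 2 by move: sw; rewrite wE !size_rcons; lia.
have Uw : uniq w := oneline_uniq sigma.
have q1 : index 1 w = 2 * n - 1.
  rewrite wE -cats1 index_cat ifN; last first.
    by move: Uw; rewrite wE rcons_uniq => /andP[].
  by rewrite /= addn0 size_rcons su; lia.
have qN : index (2 * n) w = (2 * n - 1).-1 by lia.
have E : (2 * n - 1).+1 = 2 * n by lia.
have pE x : 1 <= x <= 2 * n - 1 ->
    index x (oneline pi) = minn (index x w) (2 * n - 1).-1.
  move=> hx; rewrite piE -cats1 index_cat.
  have [->|x1] := eqVneq x 1.
    rewrite ifN; last first.
      by move: Uw; rewrite wE !rcons_uniq mem_rcons inE negb_or => /andP[/andP[]].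
    by rewrite /= q1 su; lia.
  have xw : x \in w by rewrite mem_oneline; lia.
  have xu : x \in u.
    move: xw; rewrite wE mem_rcons inE (negPf x1) mem_rcons inE /=.
    by case/orP => // /eqP; lia.
  have ixu : index x u < 2 * n - 2 by rewrite -su index_mem.
  by rewrite xu wE -!cats1 !index_cat mem_cat xu /=; lia.
have lt_q x : 1 <= x <= (2 * n - 1).+1 -> index x w < (2 * n - 1).+1.
  by rewrite E; apply: index_oneline_lt.
have inj_q x y : 1 <= x <= (2 * n - 1).+1 -> 1 <= y <= (2 * n - 1).+1 ->
    index x w = index y w -> x = y.
  by rewrite E; apply: index_oneline_inj.
have gaps (f : nat -> bool) :
    (forall x, 1 <= x <= 2 * n - 1 -> f (index x.+1 w) = f (index x w).+1) ->
  forall x, 1 <= x <= 2 * n - 1 -> f (index x w).+1 = f (2 * n - 1).+1.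
  move=> finv x hx; rewrite E (pile_gap_transitive m_gt1 pile) //; last lia.
  by move=> y hy; apply: finv; lia.
have N_gt1 : 1 < 2 * n - 1 by lia.
have qN1 : index (2 * n - 1).+1 w = (2 * n - 1).-1 by rewrite E.
(* The chord diagram is applied with N = 2n - 1, so that the entry N + 1 is 2n. *)
have := @block_positions _ (fun x => index x w) lt_q inj_q gaps N_gt1 q1 qN1 _ n erefl.
rewrite E -num_valid_contexts_sum => /(_ cnt) [down|up].
  left; apply: eq_of_index => [|k]; rewrite ?size_oneline size_rev size_iota //.
  move=> kN; rewrite nth_rev size_iota // nth_iota; last lia.
  by rewrite pE ?down; lia.
right; apply: eq_of_index.
  by rewrite size_oneline size_rcons size_flatten_pairs size_iota; lia.
move=> k; rewrite size_rcons size_flatten_pairs size_iota => kN.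
rewrite nth_rcons size_flatten_pairs size_iota nth_flatten_pairs size_iota.
have [k2|k2] := ltnP; last first.
  by rewrite ifT; last lia; rewrite pE ?q1; lia.
(* The index k lies in the pair n + i, i + 1 with i = k./2 + 1, since [iota] starts at 1; an even k
   selects n + i and an odd k selects i + 1. *)
have [i [hi ki]] : exists i, 1 <= i < n /\ i = (k./2).+1 by exists (k./2).+1; lia.
rewrite nth_iota; last lia.
have := up i hi; rewrite add1n -ki.
case: ifP => ok [up1 up2]; rewrite pE ?up1 ?up2; lia.
Qed.
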